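(* Let $\varepsilon\in(0,\tfrac12)$ be the fixed constant of the quantum planted-clique conjecture qPC, and suppose qPC holds. Let $k=k(n)$ satisfy $(2+\varepsilon)\log_2 n\le k\le n^{1/2-\varepsilon}$ and fix a threshold $\lambda\in(0,k)$. Then no efficient algorithm estimates the eigenvalue count $$N_{<\lambda}(\Delta_{k-2}):=\#\{\text{eigenvalues of }\Delta_{k-2}\text{ in }[0,\lambda)\}$$ to additive error $<\tfrac12$ with success probability $\ge\tfrac12+\delta$ over $G\sim\mathcal{D}_k$, for a constant $\delta>0$.
   Context: Graphs are simple graphs on $[n]=\{1,\dots,n\}$. $G(n,\tfrac12)$ is the Erdős–Rényi distribution (each edge present independently with probability $\tfrac12$). $G(n,\tfrac12,k)$ is obtained by drawing $G_0\sim G(n,\tfrac12)$, choosing a uniformly random $k$-subset $S\subseteq[n]$ and adding every edge inside $S$. $\mathcal{D}_k=\tfrac12G(n,\tfrac12)+\tfrac12G(n,\tfrac12,k)$. The clique complex $X(G)$ is the simplicial complex whose $d$-simplices are the $(d+1)$-cliques of $G$; $\mathrm{skel}_dX(G)$ keeps exactly the faces of dimension $\le d$. Chains are over $\mathbb{R}$ with the simplices as orthonormal basis. $\Delta_{k-2}=\partial_{k-2}^{\top}\partial_{k-2}+\partial_{k-1}\partial_{k-1}^{\top}$ is the combinatorial Laplacian of $\mathrm{skel}_{k-2}X(G)$ (here $\partial_{k-1}=0$), acting on the space of $(k-2)$-chains. Eigenvalues are counted with multiplicity; on the zero space the count is $0$. An estimate $\widehat N$ has additive error $<\eta$ if $|\widehat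 N-N|<\eta$. An efficient algorithm is a randomized or quantum algorithm with classical output running in time $\mathrm{poly}(n)$; it receives $G$, $k$ and $\lambda$. Quantum planted-clique conjecture (qPC): for every $k=k(n)$ with $(2+\varepsilon)\log_2 n\le k\le n^{1/2-\varepsilon}$ and every constant $\delta>0$, no polynomial-time quantum algorithm (knowing $n$ and $k$) distinguishes $G(n,\tfrac12)$ from $G(n,\tfrac12,k)$ with advantage $\ge\delta$, where the advantage is the absolute difference of the probabilities of outputting ''planted'' under the two distributions. ''No algorithm achieves probability (or advantage) at least $q$'' means that no algorithm achieves this for all sufficiently large $n$. *)

(* Defs.v *)
From mathcomp Require Import all_boot all_order all_algebra.
From mathcomp Require Import polyrcf complex.
From mathcomp Require Import all_classical all_reals all_analysis.

Set Implicit Arguments.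
Unset Strict Implicit.
Unset Printing Implicit Defensive.

Import Order.TTheory GRing.Theory Num.Theory.
Import numFieldNormedType.Exports.

Local Open Scope classical_set_scope.
Local Open Scope ring_scope.

(** * Graphs and random graphs *)

Definition edge (n : nat) := {e : {set 'I_n} | #|e| == 2%N}.

(* A simple graph on the vertex set 'I_n is its set of edges. *)
Definition graph (n : nat) := {set edge n}.

Definition adj n (G : graph n) : rel 'I_n :=
  fun u v => [exists e in G, val e == [set u; v]%SET].

Definition is_clique n (G : graph n) (s : {set 'I_n}) : bool :=
  [forall u in s, forall v in s, (u != v) ==> adj G u v].

Definition plant n (G : graph n) (S : {set 'I_n}) : graph n :=
  (G :|: [set e : edge n | val e \subset S])%SET.

Definition gnp_half (R : realType) n (G : graph n) : R :=
  \prod_(e : edge n) (if e \in G then 1 / 2 else 1 - 1 / 2).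

Definition gnp_planted (R : realType) n (k : nat) (G : graph n) : R :=
  \sum_(G0 : graph n) \sum_(S : {set 'I_n} | #|S| == k)
    gnp_half R G0 * ('C(n, k)%:R)^-1 * (plant G0 S == G)%:R.

Definition mixture (R : realType) n (k : nat) (G : graph n) : R :=
  1 / 2 * gnp_half R G + 1 / 2 * gnp_planted R k G.

Definition expect (R : realType) n (mu f : graph n -> R) : R :=
  \sum_(G : graph n) mu G * f G.

(** * Clique complexes and the combinatorial Laplacian *)

(* A complex is the set of its nonempty faces; a d-simplex has d+1 vertices. *)
Definition clique_complex n (G : graph n) : {set {set 'I_n}} :=
  [set s : {set 'I_n} | (s != finset.set0) && is_clique G s]%SET.

Definition skel n (d : nat) (K : {set {set 'I_n}}) : {set {set 'I_n}} :=
  [set s in K | (#|s| <= d.+1)%N]%SET.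

(* The faces with m vertices, that is, the (m-1)-simplices. There is no empty
   face, so that [cells K 0] is empty and [boundary K 0] vanishes. *)
Definition cells n (K : {set {set 'I_n}}) (m : nat) : {set {set 'I_n}} :=
  [set s in K | #|s| == m]%SET.

(* Coefficient of t in the boundary of s: (-1)^j if t is obtained from s by
   removing its j-th smallest vertex (counting from 0), and 0 otherwise. *)
Definition incidence (R : realType) n (t s : {set 'I_n}) : R :=
  \sum_(v in s | (s :\ v)%SET == t)
    (-1) ^+ #|[set u in s | (u < v)%N]%SET|.

(* The matrix, acting on column vectors and in the bases of simplices, of the
   boundary map from the d-chains to the (d-1)-chains. *)
Definition boundary (R : realType) n (K : {set {set 'I_n}}) (d : nat) :
    'M[R]_(#|cells K d|, #|cells K d.+1|) :=
  \matrix_(a, b) incidence R (enum_val a) (enum_val b).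

Definition laplacian (R : realType) n (K : {set {set 'I_n}}) (d : nat) :
    'M[R]_(#|cells K d.+1|) :=
  (boundary R K d)^T *m boundary R K d
  + boundary R K d.+1 *m (boundary R K d.+1)^T.

(* [rootsR] lists each real root once. The matrices to which this is applied are
   real symmetric, so that all the eigenvalues are real and their algebraic and
   geometric multiplicities agree. *)
Definition eig_count (R : realType) p (A : 'M[R]_p) (lam : R) : nat :=
  (\sum_(x <- rootsR (char_poly A) | (0 <= x < lam)%R) mup x (char_poly A))%N.

(* Used for 2 <= k only (the subtraction is truncated). *)
Definition low_count (R : realType) n (G : graph n) (k : nat) (lam : R) : nat :=
  eig_count (laplacian R (skel (k - 2) (clique_complex G)) (k - 2)) lam.

(** * Classically controlled quantum machines *)

(* The classical memory consists of stacks of bits (the tapes of a multitape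
   machine); qubits are addressed in unary, qubit number [size (s i)] being the
   one to which an instruction with argument i refers. A program is a finite
   object that does not depend on the input size. Classical randomized programs
   are those whose only non-classical instruction is Flip. *)
Inductive prog : Type :=
  | Skip
  | Push of nat & bool
  | Pop of nat
  | Seq of prog & prog
  (* Case i ce c0 c1 : branch on "stack i is empty / top bit 0 / top bit 1" *)
  | Case of nat & prog & prog & prog
  (* While i c : run c as long as stack i is nonempty *)
  | While of nat & prog
  (* push a fair random bit *)
  | Flip of nat
  | Hadamard of nat
  | TGate of nat
  | CNot of nat & nat
  (* Measure i j : measure a qubit and push the outcome on stack j *)
  | Measure of nat & nat.

Fixpoint deterministic (c : prog) : bool :=
  match c with
  | Skip | Push _ _ | Pop _ => true
  | Seq c d => deterministic c && deterministic d
  | Case _ ce c0 c1 => [&& deterministic ce, deterministic c0 & deterministic c1]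
  | While _ c => deterministic c
  | Flip _ | Hadamard _ | TGate _ | CNot _ _ | Measure _ _ => false
  end.

Definition store := nat -> seq bool.

Definition upd (s : store) (i : nat) (v : seq bool) : store :=
  fun j => if j == i then v else s j.

Definition basis (m : nat) := {ffun 'I_m -> bool}.

Definition setq m (x : basis m) (q : 'I_m) (b : bool) : basis m :=
  [ffun j => if j == q then b else x j].

(* Vectors of amplitudes of m qubits; they are not normalized, see [step]. *)
Definition qvec (R : realType) (m : nat) := {ffun basis m -> R[i]}.

Definition qzero (R : realType) m : qvec R m :=
  [ffun x : basis m => (x == [ffun=> false])%:R].

Definition norm2 (R : realType) m (psi : qvec R m) : R :=
  \sum_(x : basis m) (complex.Re (psi x) ^+ 2 + complex.Im (psi x) ^+ 2).

Definition isqrt2 (R : realType) : R := (Num.sqrt 2)^-1.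

Definition scaleq (R : realType) m (a : R) (psi : qvec R m) : qvec R m :=
  [ffun x => (Complex a 0) * psi x].

Definition hadamard (R : realType) m (q : 'I_m) (psi : qvec R m) : qvec R m :=
  [ffun x : basis m => (Complex (isqrt2 R) 0)
     * (psi (setq x q false) + (-1) ^+ (x q) * psi (setq x q true))].

Definition tgate (R : realType) m (q : 'I_m) (psi : qvec R m) : qvec R m :=
  [ffun x : basis m =>
     (if x q then Complex (isqrt2 R) (isqrt2 R) else 1) * psi x].

Definition cnot (R : realType) m (q r : 'I_m) (psi : qvec R m) : qvec R m :=
  [ffun x : basis m => psi (if x q then setq x r (~~ x r) else x)].

Definition project (R : realType) m (q : 'I_m) (b : bool) (psi : qvec R m) :
    qvec R m :=
  [ffun x : basis m => if x q == b then psi x else 0].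

Record config (R : realType) (m : nat) := Config {
  todo : seq prog;
  mem : store;
  amp : qvec R m }.

(* One elementary step yields the list of the possible successors; the squared
   norm of the amplitude vector of a configuration is the probability of the
   branch that leads to it. Gates on qubits that do not exist (and CNot with
   equal arguments) do nothing, and measuring such a qubit gives 0. *)
Definition step (R : realType) m (c : config R m) : seq (config R m) :=
  let s := mem c in
  let psi := amp c in
  match todo c with
  | [::] => [:: c]
  | Skip :: K => [:: Config K s psi]
  | Push i b :: K => [:: Config K (upd s i (b :: s i)) psi]
  | Pop i :: K => [:: Config K (upd s i (behead (s i))) psi]
  | Seq c1 c2 :: K => [:: Config [:: c1, c2 & K] s psi]
  | Case i ce c0 c1 :: K =>
      [:: Config ((match s i with
                   | [::] => ce
                   | b :: _ => if b then c1 else c0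
                   end) :: K) s psi]
  | While i c1 :: K =>
      [:: Config (if nilp (s i) then K else [:: c1, While i c1 & K]) s psi]
  | Flip i :: K =>
      [seq Config K (upd s i (b :: s i)) (scaleq (isqrt2 R) psi)
         | b <- [:: false; true]]
  | Hadamard i :: K =>
      [:: Config K s (match insub (size (s i)) with
                      | Some q => hadamard q psi
                      | None => psi
                      end)]
  | TGate i :: K =>
      [:: Config K s (match insub (size (s i)) with
                      | Some q => tgate q psi
                      | None => psi
                      end)]
  | CNot i j :: K =>
      [:: Config K s (match insub (size (s i)), insub (size (s j)) with
                      | Some q, Some r => if q == r then psi else cnot q r psi
                      | _, _ => psi
                      end)]
  | Measure i j :: K =>
      match insub (size (s i)) with
      | Some q => [seq Config K (upd s j (b :: s j)) (project q b psi)
                     | b <- [:: false; true]]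
      | None => [:: Config K (upd s j (false :: s j)) psi]
      end
  end.

Definition run (R : realType) m (t : nat) (c : config R m) :
    seq (config R m) :=
  iter t (fun cs => flatten (map (@step R m) cs)) [:: c].

Definition halted (R : realType) m (c : config R m) : bool := nilp (todo c).

Definition poly_bound (e n : nat) : nat := (n ^ e + e)%N.

(* A program together with a time bound n^e + e and the number n^e' + e' of
   qubits of the quantum memory, which is initially in the zero state. *)
Record qalg := QAlg {
  code : prog;
  time_exp : nat;
  qubit_exp : nat }.

Definition outcomes (R : realType) (A : qalg) (n : nat) (s : store) :
    seq (config R (poly_bound (qubit_exp A) n)) :=
  run (poly_bound (time_exp A) n) (Config [:: code A] s (@qzero R _)).

Definition in_time (R : realType) (A : qalg) (n : nat) (s : store) : bool :=
  all (@halted R _) (outcomes R A n s).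

(* Probability that the final classical memory satisfies P. *)
Definition prob (R : realType) (A : qalg) (n : nat) (s : store)
    (P : store -> bool) : R :=
  \sum_(c <- outcomes R A n s | P (mem c)) norm2 (amp c).

(** * Inputs and outputs *)

Definition adj_bits n (G : graph n) : seq bool :=
  [seq adj G u v | u <- enum 'I_n, v <- enum 'I_n].

(* n and k in unary, the adjacency matrix of the graph, and a string that
   presents the threshold, each on a stack of its own. *)
Definition input (n : nat) (g : seq bool) (k : nat) (w : seq bool) : store :=
  nth [::] [:: nseq n true; g; nseq k true; w].

(* A is efficient on the family of inputs (G, k n, w n), G a graph on n
   vertices. *)
Definition efficient (R : realType) (A : qalg) (k : nat -> nat)
    (w : nat -> seq bool) : Prop :=
  forall (n : nat) (G : graph n),
    in_time R A n (input n (adj_bits G) (k n) (w n)).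

Definition says_planted (s : store) : bool := head false (s 0%N).

(* The output estimate, in signed binary fixed point: stack 0 holds the bits of
   the integer part (least significant bit on top), stack 1 those of the
   fractional part (most significant on top); it is negative if stack 2 is
   nonempty. *)
Definition estimate (R : realType) (s : store) : R :=
  (-1) ^+ (~~ nilp (s 2%N))
  * (\sum_(i < size (s 0%N)) (nth false (s 0%N) i)%:R * 2 ^+ i
     + \sum_(j < size (s 1%N)) (nth false (s 1%N) j)%:R * 2 ^- j.+1).

(* The string w n is computable from n and k n in deterministic polynomial
   time. *)
Definition polytime_string (R : realType) (k : nat -> nat)
    (w : nat -> seq bool) : Prop :=
  exists (c : prog) (e : nat), deterministic c /\
    forall n : nat, all (fun c' : config R 0 => halted c' && (mem c' 0%N == w n))
      (run (poly_bound e n)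
         (Config [:: c] (input n [::] (k n) [::]) (@qzero R 0))).

(** * The planted clique conjecture and the estimation task *)

Definition admissible (R : realType) (eps : R) (k : nat -> nat) : Prop :=
  \forall n \near \oo,
    (2 + eps) * (ln n%:R / ln 2) <= (k n)%:R <= n%:R `^ (1 / 2 - eps).

Definition advantage (R : realType) (A : qalg) (k : nat -> nat) (n : nat) : R :=
  let accept (G : graph n) :=
    prob R A n (input n (adj_bits G) (k n) [::]) says_planted in
  `| expect (@gnp_half R n) accept - expect (@gnp_planted R n (k n)) accept |.

Definition qPC (R : realType) (eps : R) : Prop :=
  forall k : nat -> nat, admissible eps k ->
  forall delta : R, 0 < delta ->
  ~ exists A : qalg, efficient R A k (fun=> [::]) /\
      \forall n \near \oo, delta <= advantage R A k n.

(* Probability, over G drawn from D_k and the run of A, that A estimates the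
   number of eigenvalues below lam n to additive error < eta. *)
Definition success (R : realType) (A : qalg) (k : nat -> nat)
    (lam : nat -> R) (w : nat -> seq bool) (eta : R) (n : nat) : R :=
  expect (@mixture R n (k n)) (fun G : graph n =>
    prob R A n (input n (adj_bits G) (k n) (w n)) (fun s =>
      `| estimate R s - (low_count G (k n) (lam n))%:R | < eta)).

(* Main.v *)
(* A k-clique gives a kernel vector of the Laplacian, namely the boundary of the
   corresponding (k-1)-simplex: all its proper faces are in the (k-2)-skeleton,
   the simplex itself is not. So the count is positive on every planted graph.
   On the other hand, there are no eigenvalues at all in the absence of
   (k-1)-cliques, and by the union bound G(n,1/2) has none with high probability,
   since k >= (2 + eps) log_2 n. An estimate to additive error < 1/2 tells the
   two cases apart. To turn an estimator into a distinguisher, one computes the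
   string of the threshold while the input is kept on spare stacks, restores the
   input, runs the estimator and compares its output with 1/2. *)

Require Import Defs.
From mathcomp Require Import all_boot all_order all_algebra.
From mathcomp Require Import polyrcf complex.
From mathcomp Require Import all_classical all_reals all_analysis.
From mathcomp Require Import zify ring lra.
Import Order.TTheory GRing.Theory Num.Theory.
Import numFieldNormedType.Exports.
Import Defs.

Set Implicit Arguments.
Unset Strict Implicit.
Unset Printing Implicit Defensive.

Local Open Scope classical_set_scope.
Local Open Scope ring_scope.

(** * Cliques and the spectrum of the Laplacian *)

(** This is $\partial\partial=0$ at [S]: two vertices removed in either order leave the same face
    with opposite signs. It asks for the facets of [S] to lie in [K], so it also applies to a
    simplex that is itself missing from the skeleton. *)
Lemma incidence_comp (R : realType) n (K : {set {set 'I_n}}) (r S : {set 'I_n}) :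
  (forall v, v \in S -> (S :\ v)%SET \in K) ->
  \sum_(t in K) incidence R r t * incidence R t S = 0.
Proof.
move=> SK.
pose sg (s : {set 'I_n}) (v : 'I_n) : R := (-1) ^+ #|[set u in s | (u < v)%N]%SET|.
pose f u v : R := if [&& u \in S, v \in S, u != v & (S :\ v :\ u)%SET == r]
                  then sg (S :\ v)%SET u * sg S v else 0.
have -> : \sum_(t in K) incidence R r t * incidence R t S = \sum_v \sum_u f u v.
  transitivity (\sum_(v in S) incidence R r (S :\ v)%SET * sg S v).
    transitivity (\sum_(t in K) \sum_(v in S | (S :\ v)%SET == t)
                    incidence R r (S :\ v)%SET * sg S v).
      apply: eq_bigr => t tK; rewrite {2}/incidence mulr_sumr.
      by apply: eq_bigr => v /andP[_ /eqP ->].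
    rewrite (exchange_big_dep [in S]) /=; last by move=> t v _ /andP[].
    apply: eq_bigr => v vS.
    rewrite (big_pred1 (S :\ v)%SET) // => t /=.
    rewrite vS /= eq_sym; case: eqVneq => [->|_]; last by rewrite andbF.
    by rewrite SK.
  rewrite big_mkcond; apply: eq_bigr => v _; case: ifP => [vS|vS]; last first.
    by rewrite big1 // => u _; rewrite /f vS andbF.
  rewrite /incidence mulr_suml big_mkcond; apply: eq_bigr => u _.
  rewrite /f vS /= !inE; case: (u \in S) => /=; last by rewrite andbF.
  by rewrite andbT; case: ifP.
(* The two orders in which u and v can be removed contribute opposite signs. *)
have anti u v : f u v = - f v u.
  wlog uv : u v / (u < v)%N => [hw|].
    case: (ltngtP u v) => [/hw //|/hw -> |/val_inj ->]; first by rewrite opprK.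
    by rewrite /f eqxx /= !andbF oppr0.
  have uvN : u != v by apply: contraTneq uv => ->; rewrite ltnn.
  rewrite /f (eq_sym v u) uvN /=.
  have -> : (S :\ u :\ v = S :\ v :\ u)%SET by rewrite !finset.setDDl finset.setUC.
  case: (boolP (u \in S)) => uS; last by rewrite /= andbF oppr0.
  case: (boolP (v \in S)) => vS /=; last by rewrite oppr0.
  case: ifP => _; last by rewrite oppr0.
  (* Removing the larger vertex [v] leaves the number of vertices below [u] unchanged, while
     removing [u] lowers the number below [v] by one; hence the sign. *)
  have -> : sg (S :\ v)%SET u = sg S u.
    rewrite /sg; congr (_ ^+ #|pred_of_set _|); apply/setP => x; rewrite !inE.
    case: (eqVneq x v) => [->|//] /=; rewrite ltnNge (ltnW uv) /=.
    by rewrite andbF.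
  suff -> : sg S v = - sg (S :\ u)%SET v by rewrite mulrN mulrC.
  rewrite /sg (cardsD1 u) inE uS uv /= exprS mulN1r; congr (- (_ ^+ #|pred_of_set _|)).
  by apply/setP => x; rewrite !inE andbA.
(* By antisymmetry the double sum is its own negative. *)
suff /eqP : (\sum_v \sum_u f u v) *+ 2 = 0 by rewrite mulrn_eq0 => /eqP.
rewrite mulr2n {2}exchange_big /= -big_split big1 //= => v _.
rewrite -big_split big1 //= => u _.
by rewrite (anti u v) addNr.
Qed.

Lemma is_cliqueS n (G : graph n) (s t : {set 'I_n}) :
  t \subset s -> is_clique G s -> is_clique G t.
Proof.
move=> ts /forall_inP cl; apply/forall_inP => u ut.
have /forall_inP cu := cl u (fintype.subsetP ts u ut).
by apply/forall_inP => v vt; apply: cu; apply: (fintype.subsetP ts).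
Qed.

(** Without $(k-1)$-cliques the space of $(k-2)$-chains is zero, and the characteristic polynomial
    of the empty matrix is $1$, which has no roots. For $k\ge2$ the truncated [(k - 2).+1] equals
    $k-1$. *)
Lemma low_count_eq0 (R : realType) n (G : graph n) k (lam : R) :
  (1 < k)%N -> (forall s : {set 'I_n}, #|s| = k.-1 -> ~~ is_clique G s) ->
  low_count G k lam = 0%N.
Proof.
move=> k1 ncl; rewrite /low_count /eig_count.
set K := skel _ _; move: (laplacian R K (k - 2)) => L.
suff E : #|cells K (k - 2).+1| = 0%N.
  move: L; rewrite E => L.
  by rewrite /char_poly det_mx00 rootsRC big_nil.
apply/eqP; rewrite cards_eq0; apply/set0Pn => -[s].
rewrite !inE => /andP[/andP[/andP[_ cl] _] /eqP cs].
have := ncl s; rewrite cl cs => /(_ _)/negP; apply=> //; lia.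
Qed.

Lemma low_count_gt0 (R : realType) n (G : graph n) k (lam : R) (S : {set 'I_n}) :
  (1 < k)%N -> 0 < lam -> #|S| = k -> is_clique G S ->
  (0 < low_count G k lam)%N.
Proof.
move=> k1 lam0 cS clS; rewrite /low_count /eig_count.
set K := skel _ _.
set p := char_poly _.
have p0 : p != 0 by apply/monic_neq0/char_poly_monic.
(* A root at $0$ suffices, since $0\in[0,\lambda)$. *)
suff r0 : root p 0.
  have in0 : 0 \in rootsR p.
    by rewrite -(roots_on_rootsR p0) in_itv.
  rewrite (big_rem 0) //= lexx lam0 /= addn_gt0 -XsubC_dvd //.
  by rewrite dvdp_XsubCl r0.
rewrite -eigenvalue_root_char; apply/eigenvalueP.
have DK v : v \in S -> (S :\ v)%SET \in cells K (k - 2).+1.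
  move=> vS; have := cardsD1 v S; rewrite vS cS => ck.
  rewrite !inE (is_cliqueS _ clS) ?subsetDl // -cards_eq0 andbT.
  by lia.
(* [z] is the boundary of the simplex [S], written as a row vector because [eigenvalue] acts on
   rows. *)
pose z : 'rV[R]_#|cells K (k - 2).+1| := \row_b incidence R (enum_val b) S.
exists z.
  rewrite scale0r mulmxDr [X in _ + X]mulmxA.
  (* No face of the skeleton has $k$ vertices, so the second summand of the Laplacian vanishes; the
     first kills [z] by $\partial\partial=0$. *)
  have -> : boundary R K (k - 2).+1 = 0.
    apply/matrixP => a b; have := enum_valP b; rewrite !inE.
    by move=> /andP[/andP[_ h] /eqP e]; rewrite e ltnn in h.
  rewrite trmx0 mulmx0 addr0 mulmxA.
  suff -> : z *m (boundary R K (k - 2))^T = 0 by rewrite mul0mx.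
  apply/matrixP => i a; rewrite !mxE -[RHS](incidence_comp R (enum_val a) DK).
  rewrite [RHS]big_enum_val /=; apply: eq_bigr => b _.
  by rewrite !mxE mulrC.
(* [z] is nonzero: its coefficient at the facet [S :\ v] is a single sign. *)
have [v vS] : exists v, v \in S by apply/set0Pn; rewrite -cards_eq0 cS; lia.
apply/eqP => /matrixP /(_ ord0 (enum_rank_in (DK v vS) (S :\ v)%SET)).
rewrite !mxE enum_rankK_in ?DK // /incidence (big_pred1 v) => [/eqP|u].
  by rewrite signr_eq0.
rewrite /=; case: (eqVneq u v) => [->|uv]; first by rewrite vS eqxx.
apply/andP => -[uS /eqP e]; move/setP: e => /(_ u).
by rewrite !inE eqxx uS uv.
Qed.

(** * Cliques in random graphs *)

Lemma gnp_halfE (R : realType) n (G : graph n) :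
  gnp_half R G = 2 ^- #|{: edge n}|.
Proof.
rewrite /gnp_half -exprVn -prodr_const.
by apply: eq_bigr => e _; case: ifP => _; field.
Qed.

Lemma gnp_half_ge0 (R : realType) n (G : graph n) : 0 <= gnp_half R G.
Proof. by rewrite gnp_halfE invr_ge0 exprn_ge0. Qed.

(** Complementation matches the supersets of [A] with the subsets of its complement. *)
Lemma card_supsets (T : finType) (A : {set T}) :
  #|[set B : {set T} | A \subset B]%SET| = (2 ^ (#|T| - #|A|))%N.
Proof.
have -> : (#|T| - #|A| = #|~: A|)%N by rewrite [RHS]cardsCs finset.setCK.
rewrite -card_powerset -(card_imset _ (@finset.setC_inj T)).
apply: eq_card => B; rewrite powersetE.
apply/imsetP/idP => [[C]|BA]; first by rewrite inE => AC ->; rewrite finset.setCS.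
by exists (~: B)%SET; rewrite ?finset.setCK // inE -finset.setCS finset.setCK.
Qed.

Lemma gnp_half_supset (R : realType) n (A : {set edge n}) :
  \sum_(G : graph n | A \subset G) gnp_half R G = 2 ^- #|A|.
Proof.
under eq_bigr do rewrite gnp_halfE.
rewrite (eq_bigl [in [set G : {set edge n} | A \subset G]%SET]) => [|G]; last by rewrite inE.
rewrite sumr_const card_supsets.
have cA : (#|A| <= #|{: edge n}|)%N := max_card _.
rewrite -[LHS]mulr_natl natrX -[in _ ^- _](subnK cA) exprD invfM mulrA divff ?mul1r //.
Qed.

Lemma gnp_half_sum (R : realType) n : \sum_(G : graph n) gnp_half R G = 1.
Proof.
have := gnp_half_supset R (finset.set0 : {set edge n}).
rewrite cards0 expr0 invr1 => <-.
by apply: eq_bigl => G; rewrite finset.sub0set.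
Qed.

(** Being a clique becomes containing a fixed set of edges, an event whose probability
    [gnp_half_supset] gives. *)
Lemma is_cliqueE n (G : graph n) (s : {set 'I_n}) :
  is_clique G s = ([set e : edge n | val e \subset s]%SET \subset G).
Proof.
apply/forall_inP/fintype.subsetP => [cl e | sG u us].
  rewrite inE => es; have /cards2P[u [v [uv E]]] := valP e.
  move: es; rewrite E => /fintype.subsetP es.
  have us : u \in s by apply: es; rewrite !inE eqxx.
  have vs : v \in s by apply: es; rewrite !inE eqxx orbT.
  have /forall_inP/(_ v vs) := cl u us.
  rewrite uv => /existsP[e' /andP[e'G /eqP E']].
  by rewrite (_ : e = e') //; apply: val_inj; rewrite E' E.
apply/forall_inP => v vs; apply/implyP => uv.
have c2 : #|[set u; v]%SET| == 2%N by rewrite cards2 uv.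
apply/existsP; exists (Sub [set u; v]%SET c2 : edge n); rewrite /= eqxx andbT.
by apply: sG; rewrite inE /=; apply/fintype.subsetP => x; rewrite !inE => /orP[]/eqP->.
Qed.

Lemma card_edges_in n (s : {set 'I_n}) :
  #|[set e : edge n | val e \subset s]%SET| = 'C(#|s|, 2).
Proof.
rewrite -cards_draws -(card_imset _ val_inj); apply: eq_card => e.
rewrite !inE; apply/imsetP/andP => [[f]|[es c2]].
  by rewrite inE => fs ->; rewrite fs (valP f).
by exists (Sub e c2 : edge n); rewrite ?inE.
Qed.

(** Union bound over the $m$-subsets, each of which is a clique with probability $2^{-\binom
    m2}$. *)
Lemma gnp_half_has_clique (R : realType) n m :
  \sum_(G : graph n | [exists s : {set 'I_n}, (#|s| == m) && is_clique G s])
     gnp_half R G <= 'C(n, m)%:R / 2 ^+ 'C(m, 2).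
Proof.
apply: (@le_trans _ _ (\sum_(s : {set 'I_n} | #|s| == m)
   \sum_(G : graph n | is_clique G s) gnp_half R G)); last first.
  rewrite (eq_bigr (fun=> 2 ^- 'C(m, 2))) => [|s /eqP cs]; last first.
    by under eq_bigl do rewrite is_cliqueE; rewrite gnp_half_supset card_edges_in cs.
  rewrite (eq_bigl [in [set s : {set 'I_n} | #|s| == m]%SET]) => [|s]; last by rewrite inE.
  rewrite sumr_const.
  by rewrite card_draws card_ord -[leLHS]mulr_natl.
rewrite (exchange_big_dep predT) //= big_mkcond; apply: ler_sum => G _.
case: ifP => [/existsP[s /andP[cs cl]]|_]; last first.
  by apply: sumr_ge0 => *; apply: gnp_half_ge0.
rewrite (bigD1 s) ?cs //= lerDl; apply: sumr_ge0 => *; exact: gnp_half_ge0.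
Qed.

Lemma plant_clique n (G : graph n) (S : {set 'I_n}) : is_clique (plant G S) S.
Proof. by rewrite is_cliqueE finset.subsetUr. Qed.

Lemma gnp_planted_ge0 (R : realType) n k (G : graph n) : 0 <= gnp_planted R k G.
Proof.
do 2!apply: sumr_ge0 => *.
by rewrite !mulr_ge0 ?gnp_half_ge0 // invr_ge0.
Qed.

Lemma gnp_planted_clique (R : realType) n k (G : graph n) :
  gnp_planted R k G != 0 -> exists2 S : {set 'I_n}, #|S| = k & is_clique G S.
Proof.
move=> h; have [/existsP[S /andP[/eqP cS cl]]|/existsPn nex] :=
  boolP [exists S : {set 'I_n}, (#|S| == k) && is_clique G S]; first by exists S.
case/eqP: h; rewrite /gnp_planted big1 // => G0 _; rewrite big1 // => S /eqP cS.
case: eqP => [E|_]; last by rewrite mulr0.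
by have := nex S; rewrite cS -E plant_clique eqxx.
Qed.

Lemma bin_le_expn n m : ('C(n, m) <= n ^ m)%N.
Proof.
rewrite -(leq_pmul2r (fact_gt0 m)) bin_ffact.
apply: (@leq_trans (n ^ m)); last by rewrite leq_pmulr ?fact_gt0.
elim: m => [|m IH]; first by rewrite ffactn0.
by rewrite ffactnSr expnSr leq_mul ?leq_subr.
Qed.

(* [2 * 'C(m, 2) = m (m - 1)], so the square of the union bound is an m-th power. *)
Lemma sqr_union_bound (R : realType) n m :
  ('C(n, m)%:R / 2 ^+ 'C(m, 2)) ^+ 2 <= ((n ^ 2)%:R / 2 ^+ m.-1) ^+ m :> R.
Proof.
rewrite !expr_div_n -!exprM.
have -> : ('C(m, 2) * 2 = m.-1 * m)%N.
  by rewrite -[2%N in LHS]/(2`!) bin_ffact ffactnSr ffactn1 subn1 mulnC.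
rewrite ler_pM2r ?invr_gt0 ?exprn_gt0 // -natrX -natrX ler_nat -expnM mulnC expnM.
by rewrite leq_exp2r // bin_le_expn.
Qed.

(** The lower bound on $k$ gives $2^k\ge n^{2+\varepsilon}$, so the quotient is at most
    $4n^{-\varepsilon}$. *)
Lemma admissible_cvg (R : realType) (eps : R) (k : nat -> nat) (eta : R) :
  0 < eps -> admissible eps k -> 0 < eta ->
  \forall n \near \oo, (n ^ 2)%:R / 2 ^+ (k n).-2 <= eta.
Proof.
move=> e0 adm eta0.
near=> n.
have n0 : 0 < n%:R :> R by rewrite ltr0n; near: n; exact: nbhs_infty_gt.
have l2 : 0 < ln 2 :> R by rewrite ln_gt0 // ltr1n.
have /andP[lek _] : (2 + eps) * (ln n%:R / ln 2) <= (k n)%:R <= n%:R `^ (1 / 2 - eps).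
  by near: n.
have k2 : (2 : R) ^+ k n = expR ((k n)%:R * ln 2).
  by rewrite expRM_natl lnK // posrE.
have n2 : (n ^ 2)%:R = expR (2 * ln n%:R) :> R.
  by rewrite expRM_natl lnK ?posrE // natrX.
have lnn : ln (4 / eta) <= eps * ln n%:R.
  rewrite [leRHS]mulrC -ler_pdivrMr // -(ler_expR (_ / eps)) [leRHS]lnK ?posrE //.
  near: n; exact: nbhs_infty_ger.
(* The factor $4$ pays for the two lost powers of $2$; the inequality also holds where [.-2]
   truncates. *)
have : (2 : R) ^+ k n <= 4 * 2 ^+ (k n).-2.
  case: (k n) => [|[|j]] /=; rewrite ?expr0 ?expr1 ?(exprS _ j.+1) ?(exprS _ j); lra.
rewrite ler_pdivrMr ?exprn_gt0 // k2 n2 => h.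
suff : expR (2 * ln n%:R) <= eta / 4 * expR ((k n)%:R * ln 2).
  by move: (expR _) (expR _) (2 ^+ _) h => x y z h hx; nra.
have -> : eta / 4 = expR (- ln (4 / eta)).
  by rewrite expRN lnK ?posrE ?divr_gt0 // invf_div.
rewrite -expRD ler_expR.
move: lek; rewrite mulrA ler_pdivrMr //; lra.
Unshelve. all: by end_near. Qed.

(** * Probabilities of runs *)

(** Pairing the basis states that differ only in qubit [q] reduces unitarity of the Hadamard gate to
    two amplitudes at a time. *)
Lemma sum_qubit (R : realType) m (q : 'I_m) (F : basis m -> R) :
  \sum_x F x = \sum_(x : basis m | ~~ x q) (F (setq x q false) + F (setq x q true)).
Proof.
have setqN (x : basis m) b : x q = b -> setq x q b = x.
  by move=> <-; apply/ffunP => j; rewrite ffunE; case: eqP => [->|].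
rewrite (bigID (fun x : basis m => x q)) /= addrC big_split /=; congr (_ + _).
  by apply: eq_bigr => x /negbTE xq; rewrite setqN.
rewrite (reindex_onto (fun x : basis m => setq x q true)
  (fun x : basis m => setq x q false)) /=.
  apply: eq_bigl => x; rewrite ffunE eqxx /=; apply/eqP/idP => [<-|xq].
    by rewrite ffunE eqxx.
  apply/ffunP => j; rewrite !ffunE; case: eqP => // ->; exact/esym/negbTE.
by move=> x xq; apply/ffunP => j; rewrite !ffunE; case: eqP => // ->.
Qed.

Lemma isqrt2_sqr (R : realType) : isqrt2 R ^+ 2 = 1 / 2.
Proof. by rewrite /isqrt2 exprVn sqr_sqrtr // div1r. Qed.

Lemma norm2_hadamard (R : realType) m (q : 'I_m) (psi : qvec R m) :
  norm2 (hadamard q psi) = norm2 psi.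
Proof.
rewrite /norm2 !(sum_qubit q); apply: eq_bigr => x xq.
have setqq (b b' : bool) : setq (setq x q b) q b' = setq x q b'.
  by apply/ffunP => j; rewrite !ffunE; case: eqP.
rewrite !ffunE !setqq eqxx expr0 expr1 mul1r mulN1r.
case: (psi _) => a b; case: (psi _) => c d /=.
have := isqrt2_sqr R; move: (isqrt2 R) => h hh.
transitivity (2 * h ^+ 2 * (a ^+ 2 + b ^+ 2 + c ^+ 2 + d ^+ 2)); first by ring.
by rewrite hh; field.
Qed.

Lemma norm2_tgate (R : realType) m (q : 'I_m) (psi : qvec R m) :
  norm2 (tgate q psi) = norm2 psi.
Proof.
apply: eq_bigr => x _; rewrite ffunE; case: (psi x) => a b; case: (x q) => /=.
  have := isqrt2_sqr R; move: (isqrt2 R) => h hh.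
  transitivity (2 * h ^+ 2 * (a ^+ 2 + b ^+ 2)); first by ring.
  by rewrite hh; field.
by ring.
Qed.

(** For distinct qubits the gate permutes the basis states by an involution. *)
Lemma norm2_cnot (R : realType) m (q r : 'I_m) (psi : qvec R m) :
  q != r -> norm2 (cnot q r psi) = norm2 psi.
Proof.
move=> qr; pose f (x : basis m) := if x q then setq x r (~~ x r) else x.
have fK : involutive f.
  move=> x; rewrite {2}/f; case: ifP => xq; rewrite /f ?xq //.
  rewrite ffunE (negbTE qr) xq; apply/ffunP => j; rewrite !ffunE eqxx.
  by case: eqP => // ->; rewrite negbK.
rewrite [RHS](reindex_inj (inv_inj fK)); apply: eq_bigr => x _.
by rewrite !ffunE.
Qed.

Lemma norm2_project (R : realType) m (q : 'I_m) (psi : qvec R m) :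
  norm2 (project q false psi) + norm2 (project q true psi) = norm2 psi.
Proof.
rewrite /norm2 -big_split; apply: eq_bigr => x _; rewrite !ffunE.
by case: (x q); rewrite /= !expr0n /= ?addr0 ?add0r.
Qed.

Lemma norm2_scaleq (R : realType) m (a : R) (psi : qvec R m) :
  norm2 (scaleq a psi) = a ^+ 2 * norm2 psi.
Proof.
rewrite /norm2 mulr_sumr; apply: eq_bigr => x _; rewrite ffunE.
by case: (psi x) => u v /=; ring.
Qed.

Lemma norm2_ge0 (R : realType) m (psi : qvec R m) : 0 <= norm2 psi.
Proof. by apply: sumr_ge0 => x _; rewrite addr_ge0 ?sqr_ge0. Qed.

Lemma norm2_qzero (R : realType) m : norm2 (@qzero R m) = 1.
Proof.
rewrite /norm2 (bigD1 [ffun=> false]) //= big1 => [|x /negbTE x0].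
  by rewrite ffunE eqxx /= expr1n expr0n addr0 addr0.
by rewrite ffunE x0 /= !expr0n addr0.
Qed.

(** Conservation of probability: gates are unitary, a coin flip gives each branch half the weight,
    and a measurement splits the vector orthogonally. *)
Lemma norm2_step (R : realType) m (c : config R m) :
  \sum_(c' <- step c) norm2 (amp c') = norm2 (amp c).
Proof.
case: c => -[|i K] s psi; first by rewrite big_seq1.
case: i => *; rewrite /step /= ?big_seq1 //=.
- by rewrite big_cons big_seq1 /= !norm2_scaleq isqrt2_sqr; field.
- by case: insubP => [q _ _|_] //; rewrite norm2_hadamard.
- by case: insubP => [q _ _|_] //; rewrite norm2_tgate.
- case: insubP => [q _ _|_] //; case: insubP => [r _ _|_] //.
  by case: (eqVneq q r) => // qr; rewrite norm2_cnot.
- case: insubP => [q _ _|_]; last by rewrite big_seq1.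
  by rewrite big_cons big_seq1 norm2_project.
Qed.

Lemma runSr (R : realType) m t (c : config R m) :
  run t.+1 c = flatten [seq step c' | c' <- run t c].
Proof. by []. Qed.

Lemma norm2_run (R : realType) m t (c : config R m) :
  \sum_(c' <- run t c) norm2 (amp c') = norm2 (amp c).
Proof.
elim: t => [|t IH]; first by rewrite big_seq1.
rewrite runSr big_flatten big_map -[RHS]IH.
by apply: eq_bigr => c' _; apply: norm2_step.
Qed.

Lemma prob_le1 (R : realType) A n s P : prob R A n s P <= 1.
Proof.
rewrite -[leRHS](norm2_qzero R (poly_bound (qubit_exp A) n)).
rewrite -[X in norm2 X]/(amp (Config [:: code A] s (qzero R _))).
rewrite -(norm2_run (poly_bound (time_exp A) n)) /prob big_mkcond /=.
by apply: ler_sum => c _; case: ifP => // _; apply: norm2_ge0.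
Qed.

Lemma le_prob (R : realType) A n s (P Q : store -> bool) :
  (forall x, P x -> Q x) -> prob R A n s P <= prob R A n s Q.
Proof.
move=> PQ; rewrite /prob big_mkcond [leRHS]big_mkcond.
apply: ler_sum => c _; case: ifP => [/PQ -> //|_].
by case: ifP => // _; apply: norm2_ge0.
Qed.

Lemma prob_disjoint (R : realType) A n s (P Q : store -> bool) :
  (forall x, P x -> ~~ Q x) -> prob R A n s P + prob R A n s Q <= 1.
Proof.
move=> PQ; apply: le_trans (prob_le1 R A n s predT).
rewrite /prob [X in X + _]big_mkcond [X in _ + X]big_mkcond -big_split /=.
apply: ler_sum => c _; case: ifP => [/PQ/negbTE ->|_]; first by rewrite addr0.
by rewrite add0r; case: ifP => // _; apply: norm2_ge0.
Qed.

(** * Runs of composed programs *)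

Definition framed (R : realType) m (K : seq prog) (c : config R m) : config R m :=
  Config (todo c ++ K) (mem c) (amp c).

Lemma step_framed (R : realType) m K (c : config R m) :
  ~~ halted c -> step (framed K c) = [seq framed K c' | c' <- step c].
Proof.
case: c => -[|i L] s psi // _; case: i => * //=.
- by rewrite /framed /step /=; case: nilp.
- by rewrite /framed /step /=; case: insubP.
Qed.

Lemma run_add (R : realType) m a b (c : config R m) :
  run (a + b) c = flatten [seq run b c' | c' <- run a c].
Proof.
rewrite addnC; elim: b => [|b IH] /=; first by rewrite -/(run a c) flatten_seq1.
rewrite -/(run (b + a) c) IH map_flatten; elim: (run a c) => [|d l IHl] //=.
by rewrite flatten_cat IHl.
Qed.

Lemma runSl (R : realType) m t (c : config R m) :
  run t.+1 c = flatten [seq run t c' | c' <- step c].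
Proof. by rewrite -add1n run_add /run /= cats0. Qed.

Lemma run_halted (R : realType) m t (c : config R m) :
  halted c -> run t c = [:: c].
Proof.
case: c => -[|//] s psi _; elim: t => [//|t IH].
by rewrite runSl /= IH.
Qed.

Lemma run_stable (R : realType) m t t' (c : config R m) :
  (t <= t')%N -> all (@halted R m) (run t c) -> run t' c = run t c.
Proof.
move=> /subnKC <- h; rewrite run_add.
elim: (run t c) h => [|d l IH] //= /andP[hd hl].
by rewrite IH // run_halted.
Qed.

(** Branches may halt early and enter [K] before step [t1]. Since [K] halts within [t2] steps on
    each of them and halted configurations are stationary, their surplus steps change nothing. *)
Lemma run_framed (R : realType) m K t1 t2 (c : config R m) :
  all (@halted R m) (run t1 c) ->
  all (fun c' => all (@halted R m) (run t2 (framed K c'))) (run t1 c) ->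
  run (t1 + t2) (framed K c) = flatten [seq run t2 (framed K c') | c' <- run t1 c].
Proof.
elim: t1 c => [|t IH] c; first by rewrite /= cats0.
have [hc|hc] := boolP (halted c).
  rewrite run_halted //= hc cats0 !andbT => _ h.
  exact: (@run_stable _ _ t2 (t.+1 + t2)) (leq_addl _ _) h.
rewrite addSn !runSl step_framed //.
elim: (step c) => [|d l IHl] //=; rewrite !all_cat => /andP[h1 h2] /andP[h3 h4].
by rewrite map_cat flatten_cat IHl // IH.
Qed.

(** An instruction pushes at most one bit on any stack, so running time bounds memory growth; later
    this bounds the time for clearing and scanning stacks. *)
Lemma size_mem_step (R : realType) m (c : config R m) i B :
  (size (mem c i) <= B)%N ->
  all (fun c' => (size (mem c' i) <= B.+1)%N) (step c).
Proof.
case: c => -[|j K] s psi /= hB; first by rewrite leqW.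
have hu j' (b : bool) : (size (upd s j' (b :: s j') i) <= B.+1)%N.
  by rewrite /upd; case: eqP => [<-|_]; rewrite ?ltnS // leqW.
case: j => * /=; rewrite ?hu ?andbT ?leqW //.
- by rewrite /upd; case: eqP => [<-|_]; rewrite ?size_behead; lia.
- by rewrite /step /=; case: insubP => [q _ _|_] /=; rewrite ?hu.
Qed.

Lemma size_mem_run (R : realType) m t (c : config R m) i :
  all (fun c' => (size (mem c' i) <= size (mem c i) + t)%N) (run t c).
Proof.
elim: t => [|t IH]; first by rewrite /= addn0 leqnn.
rewrite runSr; elim: (run t c) IH => [|d l IHl] //= /andP[hd hl].
by rewrite all_cat IHl // addnS size_mem_step.
Qed.

(* A total-correctness triple; it is about every continuation K and all quantum
   data because the code is also run inside larger programs. *)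
Definition reaches (L : seq prog) (t : nat) (s : store) (Q : store -> Prop) :=
  exists t' s', [/\ (t' <= t)%N, Q s' &
    forall (R : realType) m K (psi : qvec R m),
      run t' (Config (L ++ K) s psi) = [:: Config K s' psi]].

Lemma reaches_nil s t (Q : store -> Prop) : Q s -> reaches [::] t s Q.
Proof. by move=> Qs; exists 0%N, s. Qed.

Lemma reaches_step L L' t s s' (Q : store -> Prop) :
  (forall (R : realType) m K (psi : qvec R m),
      step (Config (L ++ K) s psi) = [:: Config (L' ++ K) s' psi]) ->
  reaches L' t s' Q -> reaches L t.+1 s Q.
Proof.
move=> h [t' [s'' [le Qs r]]]; exists t'.+1, s''; split=> // R m K psi.
by rewrite runSl h /= r.
Qed.

Lemma reaches_cat L1 L2 t1 t2 s (Q1 Q2 : store -> Prop) :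
  reaches L1 t1 s Q1 -> (forall s1, Q1 s1 -> reaches L2 t2 s1 Q2) ->
  reaches (L1 ++ L2) (t1 + t2) s Q2.
Proof.
move=> [t1' [s1 [le1 Qs1 r1]]] /(_ s1 Qs1) [t2' [s2 [le2 Qs2 r2]]].
exists (t1' + t2')%N, s2; split=> // [|R m K psi]; first exact: leq_add.
by rewrite run_add -catA r1 /= r2.
Qed.

Lemma reaches_le L t t' s (Q Q' : store -> Prop) :
  (t <= t')%N -> (forall s', Q s' -> Q' s') -> reaches L t s Q -> reaches L t' s Q'.
Proof.
move=> le QQ [t1 [s1 [le1 Qs1 r1]]]; exists t1, s1.
by split; [exact: leq_trans le | exact: QQ |].
Qed.

Lemma reaches_seq c1 c2 t1 t2 s (Q1 Q2 : store -> Prop) :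
  reaches [:: c1] t1 s Q1 -> (forall s1, Q1 s1 -> reaches [:: c2] t2 s1 Q2) ->
  reaches [:: Seq c1 c2] (t1 + t2).+1 s Q2.
Proof.
by move=> h1 h2; apply: (@reaches_step _ [:: c1; c2]) (reaches_cat h1 h2).
Qed.

Lemma reaches_case i ce c0 c1 t s (Q : store -> Prop) :
  reaches [:: match s i with
              | [::] => ce
              | b :: _ => if b then c1 else c0
              end] t s Q ->
  reaches [:: Case i ce c0 c1] t.+1 s Q.
Proof. exact: reaches_step. Qed.

Lemma reaches_skip s t (Q : store -> Prop) : Q s -> reaches [:: Skip] t.+1 s Q.
Proof. by move=> ?; apply: (@reaches_step _ [::] _ _ s) => //; apply: reaches_nil. Qed.

Lemma reaches_push i b s t (Q : store -> Prop) :
  Q (upd s i (b :: s i)) -> reaches [:: Push i b] t.+1 s Q.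
Proof.
move=> ?; apply: (@reaches_step _ [::] _ _ (upd s i (b :: s i))) => //.
exact: reaches_nil.
Qed.

Lemma reaches_pop i s t (Q : store -> Prop) :
  Q (upd s i (behead (s i))) -> reaches [:: Pop i] t.+1 s Q.
Proof.
move=> ?; apply: (@reaches_step _ [::] _ _ (upd s i (behead (s i)))) => //.
exact: reaches_nil.
Qed.

(** The body removes exactly the top bit of stack [i], so it runs [size (s i)] times. Each round
    costs one test besides the body, and a last test ends the loop. *)
Lemma reaches_while i c t (inv : store -> Prop) s :
  (forall b l s, s i = b :: l -> inv s ->
     reaches [:: c] t s (fun s' => s' i = l /\ inv s')) ->
  inv s ->
  reaches [:: While i c] (t.+1 * size (s i)).+1 s (fun s' => s' i = [::] /\ inv s').
Proof.
move=> h; move El : (s i) => l; elim: l s El => [|b l IH] s El invs.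
  rewrite muln0; apply: (@reaches_step _ [::]) => [R m K psi|].
    by rewrite /step /= El.
  exact: reaches_nil.
rewrite mulnS addSn -addnS.
apply: (@reaches_step _ [:: c; While i c]) => [R m K psi|].
  by rewrite /step /= El.
by apply: (reaches_cat (h _ _ _ El invs)) => s1 [E1 inv1]; apply: IH.
Qed.

Definition pushes (js : seq nat) (b : bool) (c : prog) : prog :=
  foldr (fun j d => Seq (Push j b) d) c js.

(* Each copy is reversed, so that pouring it back restores the stack. *)
Definition pour (i : nat) (js : seq nat) : prog :=
  While i (Case i Skip (pushes js false (Pop i)) (pushes js true (Pop i))).

Lemma reaches_pushes js b c t s (Q : store -> Prop) : uniq js ->
  (forall s', (forall j, s' j = if j \in js then b :: s j else s j) ->
     reaches [:: c] t s' Q) ->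
  reaches [:: pushes js b c] (t + 2 * size js) s Q.
Proof.
elim: js s => [|j js IH] s /= => [_ h|/andP[jjs uq] h].
  by rewrite addn0; apply: h.
have H : reaches [:: Seq (Push j b) (pushes js b c)] (1 + (t + 2 * size js)).+1 s Q.
  apply: (@reaches_seq _ _ _ _ _ (eq (upd s j (b :: s j)))); first exact: reaches_push.
  move=> _ <-; apply: IH => // s' hs'; apply: h => i.
  rewrite hs' inE /upd; case: (eqVneq i j) => [->|//] /=.
  by rewrite (negbTE jjs).
by apply: reaches_le H => //; move: (size js) => z; lia.
Qed.

Lemma reaches_pour i js s : uniq js -> i \notin js ->
  reaches [:: pour i js] ((3 + 2 * size js) * size (s i)).+1 s
    (fun s' => forall j, s' j = if j == i then [::]
                                else if j \in js then catrev (s i) (s j) else s j).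
Proof.
move=> uq ijs.
(* What is left on stack [i], reversed onto a target, is always the final content of that target. *)
pose inv (s' : store) := forall j, j != i ->
  if j \in js then catrev (s' i) (s' j) = catrev (s i) (s j) else s' j = s j.
have := @reaches_while i (Case i Skip (pushes js false (Pop i)) (pushes js true (Pop i)))
  (2 + 2 * size js) inv s.
rewrite -/(pour i js) => H; apply: reaches_le (H _ _) => //; last 2 first.
- move=> b l s1 E inv1; apply: (reaches_case (t := 1 + 2 * size js)); rewrite E.
  rewrite (_ : (if b then _ else _) = pushes js b (Pop i)); last by case: b E.
  apply: reaches_pushes => // s2 E2; apply: reaches_pop.
  have E2i : s2 i = b :: l by rewrite E2 (negbTE ijs).
  rewrite {1}/upd eqxx E2i; split=> // j ji.
  rewrite /upd (negbTE ji) eqxx /=; have := inv1 j ji.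
  by rewrite E2; case: ifP => //; rewrite E.
- by move=> j _; case: ifP.
move=> s' [E inv'] j; case: (eqVneq j i) => [->//|ji].
by have := inv' j ji; rewrite E; case: ifP.
Qed.

(** * Setting up the input of the estimator *)

(* Meaningful for deterministic programs only. *)
Fixpoint width (c : prog) : nat :=
  match c with
  | Push i _ | Pop i => i.+1
  | Seq c d => maxn (width c) (width d)
  | Case i ce c0 c1 => maxn i.+1 (maxn (width ce) (maxn (width c0) (width c1)))
  | While i c => maxn i.+1 (width c)
  | _ => 0
  end.

Definition local (M : nat) (c : prog) : bool := deterministic c && (width c <= M)%N.

(** A deterministic program confined to the stacks below [M] sees nothing else, so two stores that
    agree there evolve in lockstep and the other stacks stay untouched. *)
Lemma step_local M c L (s s1 : store) :
  all (local M) (c :: L) -> (forall i, (i < M)%N -> s1 i = s i) ->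
  exists L' s' s1', [/\ all (local M) L', forall i, (i < M)%N -> s1' i = s' i,
    forall i, (M <= i)%N -> s1' i = s1 i &
    forall (R : realType) m K (psi : qvec R m),
      step (Config ((c :: L) ++ K) s psi) = [:: Config (L' ++ K) s' psi] /\
      step (Config ((c :: L) ++ K) s1 psi) = [:: Config (L' ++ K) s1' psi]].
Proof.
move=> /andP[lc lL] E.
have updE i v v' : (i < M)%N -> v = v' ->
    (forall j, (j < M)%N -> upd s1 i v j = upd s i v' j) /\
    (forall j, (M <= j)%N -> upd s1 i v j = s1 j).
  move=> iM ->; split=> j jM; rewrite /upd; case: eqP => // ji; first exact: E.
  by lia.
case: c lc => //=.
- by exists L, s, s1.
- move=> i b iM; have [] := updE i (b :: s1 i) (b :: s i) iM; first by rewrite E.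
  by move=> h1 h2; exists L, (upd s i (b :: s i)), (upd s1 i (b :: s1 i)).
- move=> i iM; have [] := updE i (behead (s1 i)) (behead (s i)) iM; first by rewrite E.
  by move=> h1 h2; exists L, (upd s i (behead (s i))), (upd s1 i (behead (s1 i))).
- move=> c d; rewrite /local /= geq_max => /andP[/andP[dc dd] /andP[wc wd]].
  by exists [:: c, d & L], s, s1; rewrite /= /local dc dd wc wd.
- move=> i ce c0 c1; rewrite /local /= !geq_max.
  move=> /andP[/and3P[de d0 d1] /and4P[iM we w0 w1]].
  exists (match s i with [::] => ce | b :: _ => if b then c1 else c0 end :: L), s, s1.
  split=> // [|R m K psi]; last by rewrite /step /= E.
  by apply/andP; split=> //; case: (s i) => [|[] l]; rewrite /local ?de ?d0 ?d1 ?we ?w0 ?w1.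
- move=> i c; rewrite /local /= geq_max => /and3P[dc iM wc].
  exists (if nilp (s i) then L else [:: c, While i c & L]), s, s1.
  split=> // [|R m K psi]; last by rewrite /step /= E //; case: (nilp _).
  case: nilp => //; apply/and3P; split=> //; rewrite /local /= dc ?wc //.
  by rewrite geq_max iM wc.
Qed.

(** Transfers a run of [c] on its bare input, without qubits, to a store that also holds saved data
    from [M] on, with any quantum memory. *)
Lemma reaches_local (R : realType) m M T L (s s1 : store) (psi : qvec R m)
    (P : store -> bool) :
  all (local M) L -> (forall i, (i < M)%N -> s1 i = s i) ->
  all (fun c' => halted c' && P (mem c')) (run T (Config L s psi)) ->
  reaches L T s1
    (fun s1' => exists2 s', P s' & forall i, s1' i = if (i < M)%N then s' i else s1 i).
Proof.
have done T' s' s1' : (forall i, (i < M)%N -> s1' i = s' i) -> P s' ->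
    reaches [::] T' s1'
    (fun s1'' => exists2 s', P s' & forall i, s1'' i = if (i < M)%N then s' i else s1' i).
  move=> E Ps; apply: reaches_nil; exists s' => // i.
  by case: ltnP => // iM; rewrite E.
elim: T L s s1 => [|T IH] [|c L] s s1 lL E //.
- by rewrite /= => /andP[Ps _]; apply: done E Ps.
- by rewrite run_halted //= => /andP[Ps _]; apply: done E Ps.
have [L' [s' [s1' [lL' E' E1 st]]]] := step_local lL E.
rewrite runSl; have [] := st R m [::] psi; rewrite !cats0 => -> _ /=.
rewrite cats0 => h; apply: (@reaches_step _ L' _ _ s1') => [R' m' K psi'|].
  by have [] := st R' m' K psi'.
apply: reaches_le (IH _ _ _ lL' E' h) => // s1'' [s'' Ps'' E''].
by exists s'' => // i; rewrite E''; case: ltnP => // /E1.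
Qed.

(** Association lists with the empty stack as default reduce equality of stores to a case split on
    the stack number. *)
Definition stacks (l : seq (nat * seq bool)) : store :=
  fun j => foldr (fun p r => if j == p.1 then p.2 else r) [::] l.

Lemma inputE n g k w :
  input n g k w = stacks [:: (0, nseq n true); (1, g); (2, nseq k true); (3, w)]%N.
Proof. by apply/funext => -[|[|[|[|j]]]]; rewrite /input /stacks //= nth_nil. Qed.

Lemma reaches_pour_stacks i js l l' B : uniq js -> i \notin js ->
  (size js <= 2)%N -> (size (stacks l i) <= B)%N ->
  (forall j : nat, (if j == i then [::]
     else if j \in js then catrev (stacks l i) (stacks l j) else stacks l j)
     = stacks l' j) ->
  reaches [:: pour i js] (7 * B + 1) (stacks l) (eq (stacks l')).
Proof.
move=> uq ijs js2 iB E; apply: reaches_le (reaches_pour (stacks l) uq ijs).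
  move: (size js) (size _) js2 iB => a b a2 bB; nia.
by move=> s' hs'; apply/funext => j; rewrite hs' E.
Qed.

Definition seqs (L : seq prog) : prog := foldr Seq Skip L.

(** Pouring a stack into no target empties it. *)
Definition clear (js : seq nat) : prog := seqs [seq pour j [::] | j <- js].

Lemma reaches_clear js s B : {in js, forall j, (size (s j) <= B)%N} ->
  reaches [:: clear js] ((3 * B + 2) * size js + 1) s
    (fun s' => forall j, s' j = if j \in js then [::] else s j).
Proof.
elim: js s => [|i js IH] s hB; first by rewrite muln0; apply: reaches_skip.
have H : reaches [:: clear (i :: js)]
    ((3 * B + 1) + ((3 * B + 2) * size js + 1)).+1 s
    (fun s' => forall j, s' j = if j \in i :: js then [::] else s j).
  apply: (@reaches_seq _ _ _ _ _ (fun s' => forall j, s' j = if j == i then [::] else s j)).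
    apply: reaches_le (@reaches_pour i [::] s isT isT) => //.
    by have := hB i (mem_head _ _); rewrite muln0 addn0; move: (size _) => z; lia.
  move=> s1 E1; apply: reaches_le (IH s1 _) => // [s' E j|j jjs].
    by rewrite E E1 inE; case: (j == i) (j \in js) => -[].
  by rewrite E1; case: ifP => // _; apply: hB; rewrite inE jjs orbT.
by apply: reaches_le H => //; rewrite [size (_ :: _)]/=; move: (size js) => z; lia.
Qed.

(* The program c computes the string for the threshold but may destroy its input
   and leave garbage below M, so copies of the input wait on the stacks M, M + 1
   and M + 2 while c runs; the stack M + 3 is scratch space. *)
Definition setup (M : nat) (c : prog) : prog :=
  seqs [:: pour 0 [:: M; M + 3]; pour (M + 3) [:: 0]; pour 1 [:: M + 1];
           pour 2 [:: M + 2; M + 3]; pour (M + 3) [:: 2];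
           c; clear (iota 1 M.-1);
           pour 0 [:: M + 3]; pour (M + 3) [:: 3];
           pour M [:: 0]; pour (M + 1) [:: 1]; pour (M + 2) [:: 2]]%N.

Lemma reaches_seqs c L t1 t2 s (Q1 Q2 : store -> Prop) :
  reaches [:: c] t1 s Q1 -> (forall s1, Q1 s1 -> reaches [:: seqs L] t2 s1 Q2) ->
  reaches [:: seqs (c :: L)] (t1 + t2).+1 s Q2.
Proof. exact: reaches_seq. Qed.

Lemma reaches_seqs_pour i js L l l' B t (Q : store -> Prop) :
  uniq js -> i \notin js -> (size js <= 2)%N -> (size (stacks l i) <= B)%N ->
  (forall j : nat, (if j == i then [::]
     else if j \in js then catrev (stacks l i) (stacks l j) else stacks l j)
     = stacks l' j) ->
  reaches [:: seqs L] t (stacks l') Q ->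
  reaches [:: seqs (pour i js :: L)] ((7 * B + 2) + t) (stacks l) Q.
Proof.
move=> uq ijs js2 iB E h.
have H : reaches [:: seqs (pour i js :: L)] ((7 * B + 1) + t).+1 (stacks l) Q.
  by apply: reaches_seq (reaches_pour_stacks uq ijs js2 iB E) _ => _ <-.
by apply: reaches_le H => //; lia.
Qed.

Ltac solve_stacks :=
  rewrite /stacks /= ?inE;
  repeat (case: eqP => [?|?] /=; rewrite ?inE; try by [exfalso; lia]);
  rewrite ?catrevE ?rev_nseq ?revK ?cats0 //.

Lemma all_forall (T I : Type) (p : I -> pred T) (r : seq T) (js : seq I) :
  (forall i, all (p i) r) -> all (fun x => all (p^~ x) js) r.
Proof.
elim: r => [//|x r IH] h /=; rewrite IH => [|i]; last by have /andP[] := h i.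
by rewrite andbT; elim: js {IH} => //= i js ->; have /andP[->] := h i.
Qed.

Lemma reaches_setup (R : realType) M c n g k w T B (psi : qvec R 0) :
  (3 < M)%N -> local M c ->
  all (fun c' => halted c' && (mem c' 0%N == w))
    (run T (Config [:: c] (input n [::] k [::]) psi)) ->
  (n + k + T <= B)%N -> (size g <= B)%N ->
  reaches [:: setup M c] (10 * (7 * B + 2) + (T + ((3 * B + 2) * M + 5)))
    (input n g k [::]) (eq (input n g k w)).
Proof.
move=> M3 lc hT hB gB; rewrite !inputE.
set N := nseq n true; set Kk := nseq k true.
have NB : (size N <= B)%N by rewrite size_nseq; lia.
have KB : (size Kk <= B)%N by rewrite size_nseq; lia.
pose p := (7 * B + 2)%N.
pose tc := ((3 * B + 2) * size (iota 1 M.-1) + 1)%N.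
pose t1 := (p + (p + (p + (p + (p + 1)))))%N.
have H : reaches [:: setup M c] (p + (p + (p + (p + (p + (T + (tc + t1).+1).+1)))))
   (stacks [:: (0, N); (1, g); (2, Kk); (3, [::])]%N)
   (eq (stacks [:: (0, N); (1, g); (2, Kk); (3, w)]%N)).
  apply: (@reaches_seqs_pour _ _ _ _ [:: (1, g); (2, Kk); (M, N); (M + 3, N)]%N) => //.
  - by rewrite /= inE; lia.
  - by rewrite !inE; lia.
  - by move=> j; solve_stacks.
  apply: (@reaches_seqs_pour _ _ _ _ [:: (0, N); (1, g); (2, Kk); (M, N)]%N) => //.
  - by rewrite !inE; lia.
  - by solve_stacks.
  - by move=> j; solve_stacks.
  (* Stack 1 is left empty because [c] is specified on inputs without a graph. The copy on [M + 1]
     stays reversed until it is poured back; unary strings equal their reversals. *)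
  apply: (@reaches_seqs_pour _ _ _ _ [:: (0, N); (2, Kk); (M, N); (M + 1, rev g)]%N) => //.
  - by rewrite !inE; lia.
  - by move=> j; solve_stacks.
  apply: (@reaches_seqs_pour _ _ _ _
    [:: (0, N); (M, N); (M + 1, rev g); (M + 2, Kk); (M + 3, Kk)]%N) => //.
  - by rewrite /= inE; lia.
  - by rewrite !inE; lia.
  - by move=> j; solve_stacks.
  pose l5 := [:: (0, N); (2, Kk); (M, N); (M + 1, rev g); (M + 2, Kk)]%N.
  apply: (@reaches_seqs_pour _ _ _ _ l5) => //.
  - by rewrite !inE; lia.
  - by solve_stacks.
  - by move=> j; rewrite /l5; solve_stacks.
  (* The garbage left by [c] has to be bounded for the clearing: each stack below [M] holds at most
     its input plus [T] bits. *)
  pose small (s : store) := all (fun i => (size (s i) <= B)%N) (iota 0 M).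
  apply: (@reaches_seqs _ _ T _ _ (fun s1 => exists2 s',
    (s' 0%N == w) && small s' &
    forall i, s1 i = if (i < M)%N then s' i else stacks l5 i)).
    apply: (@reaches_local R 0 M T [:: c] (input n [::] k [::]) _ psi
      (fun s => (s 0%N == w) && small s)).
  - by rewrite /= lc.
  - by move=> i iM; rewrite inputE /l5; solve_stacks.
  - have small_run := @all_forall _ nat (fun i (c' : config R 0) => (size (mem c' i) <= B)%N)
      (run T (Config [:: c] (input n [::] k [::]) psi)) (iota 0 M).
    have/small_run {small_run} : forall i, all (fun c' => (size (mem c' i) <= B)%N)
        (run T (Config [:: c] (input n [::] k [::]) psi)).
      move=> i; apply: sub_all (size_mem_run T _ i) => c' /= le.
      apply: leq_trans le _; apply: leq_trans hB; rewrite leq_add2r inputE.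
      by rewrite /stacks /=; do 4?case: eqP => _; rewrite ?size_nseq //; lia.
    by move: hT; rewrite /small; elim: (run _ _) => //= c' r IH
      /andP[/andP[-> ->] /IH h] /andP[-> /h ->].
  move=> s1 [s' /andP[/eqP w' sB] E].
  have s'B i : (i < M)%N -> (size (s' i) <= B)%N.
    by move=> iM; apply: (allP sB); rewrite mem_iota.
  have wB : (size w <= B)%N by rewrite -w' s'B //; lia.
  apply: reaches_seqs (reaches_clear (B := B) _) _.
    by move=> j; rewrite mem_iota => jM; rewrite E; case: ifP => jM'; [exact: s'B|lia].
  move=> s2 E2.
  have {E2} -> : s2 = stacks [:: (0, w); (M, N); (M + 1, rev g); (M + 2, Kk)]%N.
    apply/funext => j; rewrite E2 mem_iota E.
    case: ifP => jM; first by solve_stacks.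
    case: ifP => jM'; last by rewrite /l5; solve_stacks.
    have -> : j = 0%N by lia.
    by rewrite w'.
  (* Two pours through [M + 3] carry [w] from stack 0 to stack 3 in its original order. *)
  apply: (@reaches_seqs_pour _ _ _ _
    [:: (M, N); (M + 1, rev g); (M + 2, Kk); (M + 3, rev w)]%N) => //.
  - by rewrite !inE; lia.
  - by move=> j; solve_stacks.
  apply: (@reaches_seqs_pour _ _ _ _
    [:: (3, w); (M, N); (M + 1, rev g); (M + 2, Kk)]%N) => //.
  - by rewrite !inE; lia.
  - by solve_stacks; rewrite size_rev.
  - by move=> j; solve_stacks.
  apply: (@reaches_seqs_pour _ _ _ _
    [:: (0, N); (3, w); (M + 1, rev g); (M + 2, Kk)]%N) => //.
  - by rewrite !inE; lia.
  - by solve_stacks.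
  - by move=> j; solve_stacks.
  apply: (@reaches_seqs_pour _ _ _ _ [:: (0, N); (1, g); (3, w); (M + 2, Kk)]%N) => //.
  - by rewrite !inE; lia.
  - by solve_stacks; rewrite size_rev.
  - by move=> j; solve_stacks.
  apply: (@reaches_seqs_pour _ _ _ _ [:: (0, N); (1, g); (2, Kk); (3, w)]%N) => //.
  - by rewrite !inE; lia.
  - by solve_stacks.
  - by move=> j; solve_stacks.
  exact: reaches_skip.
apply: reaches_le H => //; rewrite /tc /t1 /p size_iota.
have : ((3 * B + 2) * M.-1 <= (3 * B + 2) * M)%N by rewrite leq_mul2l leq_pred orbT.
move: ((3 * B + 2) * M.-1)%N ((3 * B + 2) * M)%N => x y; lia.
Qed.

(** * The distinguisher *)

(* Tests whether the estimate is at least 1/2, the weight of the top bit of its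
   fractional part. *)
Definition reads_positive (s : store) : bool :=
  nilp (s 2%N) && (has id (s 0%N) || head false (s 1%N)).

(** Stack 3 is emptied and becomes a flag, nonempty once a 1 has been seen. Stack 0 is consumed by
    the scan, so the answer can be written on it. *)
Definition decide : prog :=
  seqs [:: pour 3 [::];
           Case 1 Skip Skip (Push 3 true);
           While 0 (Case 0 Skip (Pop 0) (Seq (Push 3 true) (Pop 0)));
           Case 2 (Case 3 Skip (Push 0 true) (Push 0 true)) Skip Skip]%N.

Lemma reaches_decide s :
  reaches [:: decide] (5 * (size (s 0%N) + size (s 3%N)) + 20) s
    (fun s' => says_planted s' = reads_positive s).
Proof.
pose b1 := head false (s 1%N).
pose Q1 (s' : store) := [/\ s' 0%N = s 0%N, s' 1%N = s 1%N, s' 2%N = s 2%N & s' 3%N = [::]].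
pose Q2 (s' : store) := [/\ s' 0%N = s 0%N, s' 2%N = s 2%N & nilp (s' 3%N) = ~~ b1].
(* A 1 popped from stack 0 sets the flag, so the truth value of having an empty flag and no 1 left
   on stack 0 never changes. *)
pose inv (s' : store) := s' 2%N = s 2%N /\
  nilp (s' 3%N) && ~~ has id (s' 0%N) = ~~ b1 && ~~ has id (s 0%N).
pose Q3 (s' : store) := s' 0%N = [::] /\ inv s'.
have H : reaches [:: decide] ((3 * size (s 3%N)).+1
    + (2 + ((5 * size (s 0%N)).+1 + (3 + 1).+1).+1).+1).+1 s
    (fun s' => says_planted s' = reads_positive s).
  apply: (@reaches_seqs _ _ _ _ _ Q1).
    apply: reaches_le (@reaches_pour 3 [::] s isT isT); first by rewrite muln0 addn0.
    by move=> s' E; split; rewrite E.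
  move=> s1 [E0 E1 E2 E3]; apply: (@reaches_seqs _ _ _ _ _ Q2).
    apply: reaches_case; rewrite E1 /Q2 /b1.
    case: (s 1%N) => [|[] l]; first by apply: reaches_skip; rewrite E3.
      by apply: reaches_push; rewrite /upd.
    by apply: reaches_skip; rewrite E3.
  move=> s2 [F0 F2 F3]; apply: (@reaches_seqs _ _ _ _ _ Q3).
    rewrite -F0; apply: (@reaches_while 0 _ 4 inv); last by rewrite /inv F0 F2 F3.
    move=> b l s' E [I2 I3]; apply: reaches_case; rewrite E.
    move: I3; rewrite E /inv; case: b {E} (E) => /= E I3.
      apply: (@reaches_seq _ _ 1 1 _ (eq (upd s' 3 (true :: s' 3%N)))).
        exact: reaches_push.
      move=> _ <-; apply: reaches_pop; rewrite /upd /= E; split=> //; split=> //.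
      by rewrite -I3 andbF.
    by apply: reaches_pop; rewrite /upd /= E.
  move=> s3 [G0 [G2 G3]]; apply: (@reaches_seqs _ _ 3 1 _ 
    (fun s' => says_planted s' = reads_positive s)).
    have {}G3 : ~~ nilp (s3 3%N) = has id (s 0%N) || b1.
      by move: G3; rewrite G0 /= andbT => ->; rewrite negb_and !negbK orbC.
    rewrite /reads_positive -/b1 -G3 /says_planted; apply: reaches_case.
    rewrite -G2; case: (s3 2%N) => [|[] l]; last 2 first.
    - by apply: reaches_skip; rewrite G0.
    - by apply: reaches_skip; rewrite G0.
    apply: reaches_case; case: (s3 3%N) => [|[] l]; first by apply: reaches_skip; rewrite G0.
      by apply: reaches_push.
    by apply: reaches_push.
  by move=> s4 h; apply: reaches_skip.
by apply: reaches_le H => //; lia.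
Qed.

(** * Closure properties of polynomial bounds *)

Definition poly_bounded (f : nat -> nat) : Prop :=
  exists e, forall n, (f n <= poly_bound e n)%N.

Lemma poly_boundedD f g : poly_bounded f -> poly_bounded g ->
  poly_bounded (fun n => f n + g n)%N.
Proof.
(* For $x\ge2$, $x^a+x^b\le2x^{a+b}\le x^{a+b+2}$; for $n\le1$ the additive [2] absorbs the
   powers. *)
move=> [a ha] [b hb]; exists (a + b + 2)%N => n.
apply: leq_trans (leq_add (ha n) (hb n)) _; rewrite /poly_bound.
have exp0_le1 c : (0 ^ c <= 1)%N by case: c => // c; rewrite exp0n.
case: n => [|[|n]]; first by rewrite (leq_trans _ (leq_addl _ _)) // addn2;
    have := exp0_le1 a; have := exp0_le1 b; lia.
  by rewrite !exp1n; lia.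
set x := n.+2; have xa : (x ^ a <= x ^ (a + b))%N by rewrite leq_pexp2l ?leq_addr.
have xb : (x ^ b <= x ^ (a + b))%N by rewrite leq_pexp2l ?leq_addl.
have : (2 * x ^ (a + b) <= x ^ (a + b + 2))%N.
  by rewrite addn2 !expnS mulnA leq_mul2r -[2%N]/(2 * 1)%N leq_mul ?orbT.
lia.
Qed.

Lemma poly_bounded_const c : poly_bounded (fun=> c).
Proof. by exists c => n; rewrite leq_addl. Qed.

Lemma poly_boundedM c f : poly_bounded f -> poly_bounded (fun n => c * f n)%N.
Proof.
move=> hf; elim: c => [|c IH]; first exact: poly_bounded_const.
have [e he] := poly_boundedD hf IH.
by exists e => n; rewrite mulSn.
Qed.

Lemma poly_bounded_expn e : poly_bounded (expn^~ e).
Proof. by exists e => n; rewrite leq_addr. Qed.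

Lemma poly_bounded_bound e : poly_bounded (poly_bound e).
Proof. by exists e. Qed.

(** * Composition of setup, estimator and decision *)

Lemma size_adj_bits n (G : graph n) : size (adj_bits G) = (n * n)%N.
Proof. by rewrite size_allpairs size_enum_ord. Qed.

Lemma run_trans (R : realType) m a b (c d : config R m) :
  run a c = [:: d] -> run (a + b) c = run b d.
Proof. by move=> E; rewrite run_add E /= cats0. Qed.

Lemma run_seq (R : realType) m c d K s (psi : qvec R m) :
  run 1 (Config (Seq c d :: K) s psi) = [:: Config [:: c, d & K] s psi].
Proof. by []. Qed.

Lemma run_decide (R : realType) m t (c : config R m) : halted c ->
  (5 * (size (mem c 0%N) + size (mem c 3%N)) + 20 <= t)%N ->
  exists2 s', says_planted s' = reads_positive (mem c) &
    run t (framed [:: decide] c) = [:: Config [::] s' (amp c)].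
Proof.
case: c => -[|//] s psi _ /= ht.
have [t' [s' [le E r]]] := reaches_decide s; exists s' => //.
have := r R m [::] psi; rewrite /framed /= => r'.
by rewrite (@run_stable _ _ t') ?r' // (leq_trans le).
Qed.

Lemma size_output (R : realType) c t (s : store) (v : seq bool) :
  all (fun c' : config R 0 => halted c' && (mem c' 0%N == v))
    (run t (Config [:: c] s (qzero R 0))) ->
  (size v <= size (s 0%N) + t)%N.
Proof.
(* Conservation of the norm shows that the list of outcomes is not empty, so that some outcome does
   hold [v]. *)
have := norm2_run t (Config [:: c] s (qzero R 0)).
have := size_mem_run t (Config [:: c] s (qzero R 0)) 0.
case: (run _ _) => [|c' l] /=; last by move=> /andP[le _] _ /andP[/andP[_ /eqP <-]].
by rewrite big_nil norm2_qzero => _ /eqP; rewrite eq_sym oner_eq0.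
Qed.

(** Setup and decision are deterministic: they neither split branches nor change amplitudes, so the
    probabilities agree exactly. The linear bound on [k] keeps the unary input polynomial at every
    [n]. *)
Lemma estimator_to_distinguisher (R : realType) (k : nat -> nat) (w : nat -> seq bool)
    (K0 : nat) (A : qalg) :
  (forall n, (k n <= n + K0)%N) -> polytime_string R k w -> efficient R A k w ->
  exists B : qalg, efficient R B k (fun=> [::]) /\
    forall n (G : graph n),
      prob R B n (input n (adj_bits G) (k n) [::]) says_planted =
      prob R A n (input n (adj_bits G) (k n) (w n)) reads_positive.
Proof.
move=> kK [c [e [dc hw]]] effA.
pose M := (width c + 4)%N.
have M3 : (3 < M)%N by rewrite /M; lia.
have lc : local M c by rewrite /local dc leq_addr.
(* [B n] bounds the adjacency matrix, and also the unary inputs together with the running time of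
   [c]. *)
pose B n := (n ^ 2 + (2 * n + K0 + poly_bound e n))%N.
pose TA := poly_bound (time_exp A).
pose ts n := (10 * (7 * B n + 2) + (poly_bound e n + ((3 * B n + 2) * M + 5)))%N.
pose td n := (5 * (2 * (B n + TA n)) + 20)%N.
have [eB heB] : poly_bounded (fun n => (ts n + (TA n + td n).+1).+1).
  have pB : poly_bounded B.
    do 2?apply: poly_boundedD; first exact: poly_bounded_expn.
      apply: poly_boundedD (poly_bounded_const _); apply: poly_boundedM.
      exact: poly_bounded_expn 1.
    exact: poly_bounded_bound.
  have pA : poly_bounded TA := poly_bounded_bound _.
  (* The constants are the coefficients of [B n] and [TA n] and the constant term in the expansion
     of the total time. *)
  have [f hf] := poly_boundedD (poly_boundedD (poly_boundedM (70 + 3 * M + 10) pB)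
    (poly_boundedM 11 pA)) (poly_boundedD (poly_bounded_bound e)
      (poly_bounded_const (20 + 2 * M + 5 + 22))).
  exists f => n; apply: leq_trans (hf n); rewrite /ts /td.
  by move: (B n) (TA n) (poly_bound e n) => x y z; nia.
pose Bq := QAlg (Seq (setup M c) (Seq (code A) decide)) eB (qubit_exp A).
have runB n (G : graph n) :
    let outs := outcomes R A n (input n (adj_bits G) (k n) (w n)) in
    let F c' := run (td n) (framed [:: decide] c') in
    [/\ outcomes R Bq n (input n (adj_bits G) (k n) [::]) = flatten (map F outs),
      all (@halted R _) (flatten (map F outs)) &
      \sum_(c' <- flatten (map F outs) | says_planted (mem c')) norm2 (amp c') =
      \sum_(c' <- outs | reads_positive (mem c')) norm2 (amp c')].
  set s1 := input n (adj_bits G) (k n) (w n).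
  move=> outs F.
  have nB : (n + k n + poly_bound e n <= B n)%N.
    by rewrite /B; move: (kK n) (poly_bound e n) (n ^ 2)%N => h x y; lia.
  have gB : (size (adj_bits G) <= B n)%N by rewrite size_adj_bits /B mulnn leq_addr.
  have [t' [_ [t'le <- r]]] := reaches_setup M3 lc (hw n) nB gB.
  (* The time of [decide] depends on stacks 0 and 3 as the estimator leaves them: at most their
     initial size plus its running time. *)
  have sB : all (fun c' : config R _ => [&& halted c',
      (size (mem c' 0%N) <= B n + TA n)%N & (size (mem c' 3%N) <= B n + TA n)%N]) outs.
    have s0B : (size (s1 0%N) <= B n)%N by rewrite size_nseq; lia.
    have s3B : (size (s1 3%N) <= B n)%N.
      by have := size_output (hw n); rewrite size_nseq => h; apply: leq_trans h _; lia.
    have hA := effA n G; rewrite /in_time -/s1 -/outs in hA.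
    have h0 := size_mem_run (TA n) (Config [:: code A] s1 (qzero R (poly_bound (qubit_exp A) n))) 0.
    have h3 := size_mem_run (TA n) (Config [:: code A] s1 (qzero R (poly_bound (qubit_exp A) n))) 3.
    rewrite -/(outcomes R A n s1) -/outs /= in h0 h3.
    move: hA h0 h3; elim: (outs) => //= c' l IH /andP[-> h] /andP[h0 h0'] /andP[h3 h3'].
    by rewrite IH // (leq_trans h0) ?(leq_trans h3) ?leq_add2r.
  have FE : all (fun c' => all (@halted R _) (F c')) outs /\
      \sum_(c' <- flatten (map F outs) | says_planted (mem c')) norm2 (amp c') =
      \sum_(c' <- outs | reads_positive (mem c')) norm2 (amp c').
    rewrite big_flatten big_map.
    elim: (outs) sB => [|c' l IH]; first by rewrite !big_nil.
    move=> /andP[/and3P[hc h0 h3] /IH[hl El]]; rewrite !big_cons El /= hl andbT /F.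
    have [|s' E ->] := @run_decide _ _ (td n) c' hc; first by rewrite /td; lia.
    by rewrite big_cons big_nil E /=; case: ifP; rewrite ?addr0 ?add0r.
  have [F1 E1] := FE.
  have hF : all (@halted R _) (flatten (map F outs)).
    by elim: (outs) F1 => //= c' l IH /andP[h /IH]; rewrite all_cat h.
  split=> //.
  (* The two single steps unfold the two [Seq] of the program. *)
  have outsE : run (1 + (t' + (1 + (TA n + td n))))
      (Config [:: code Bq] (input n (adj_bits G) (k n) [::]) (qzero R _)) =
      flatten (map F outs).
    rewrite (run_trans _ (run_seq _ _ _ _ _)) (run_trans _ (r _ _ _ _)).
    rewrite (run_trans _ (run_seq _ _ _ _ _)).
    exact: (@run_framed R _ [:: decide] (TA n) (td n)
      (Config [:: code A] s1 (qzero R _)) (effA n G) F1).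
  rewrite /outcomes -outsE; apply: run_stable; last by rewrite outsE.
  apply: leq_trans (heB n); have : (t' <= ts n)%N := t'le.
  by move: (ts n) (td n) (TA n) => x y z; lia.
exists Bq; split=> [n G|n G].
  by rewrite /in_time; have [-> ? _] := runB n G.
by rewrite /prob; have [-> _ ->] := runB n G.
Qed.

(** * Asymptotics *)

Lemma integer_bits (R : realType) (l : seq bool) :
  let I := \sum_(i < size l) (nth false l i)%:R * 2 ^+ i : R in
  if has id l then 1 <= I else I == 0.
Proof.
elim: l => [|b l IH] /=; first by rewrite big_ord0.
have -> : \sum_(i < (size l).+1) (nth false (b :: l) i)%:R * 2 ^+ i =
    b%:R + 2 * \sum_(i < size l) (nth false l i)%:R * 2 ^+ i :> R.
  rewrite big_ord_recl /= expr0 mulr1 mulr_sumr; congr (_ + _).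
  by apply: eq_bigr => i _; rewrite /= exprS mulrCA.
move: IH => /=; move: (\sum_(i < _) _) => I.
case: b => /=; case: (has id l) => [|/eqP] h //; try lra.
Qed.

(** Prepending a bit [b] turns the value $F$ into $(b+F)/2$, so the top bit decides on which side of
    $\tfrac12$ the value lies. The non-strict bounds go with an error strictly below $\tfrac12$. *)
Lemma fractional_bits (R : realType) (l : seq bool) :
  let F := \sum_(j < size l) (nth false l j)%:R * 2 ^- j.+1 : R in
  if head false l then 1 / 2 <= F <= 1 else 0 <= F <= 1 / 2.
Proof.
elim: l => [|b l IH] /=; first by rewrite big_ord0; lra.
have -> : \sum_(j < (size l).+1) (nth false (b :: l) j)%:R * 2 ^- j.+1 =
    (b%:R + \sum_(j < size l) (nth false l j)%:R * 2 ^- j.+1) / 2 :> R.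
  rewrite big_ord_recl /= expr1 mulrDl mulr_suml; congr (_ + _).
  by apply: eq_bigr => i _; rewrite /= (exprS _ i.+1) invfM mulrA mulrAC.
move: IH => /=; case: b; case: (head false l) => /=; lra.
Qed.

Lemma estimate_reads_positive (R : realType) (s : store) (N : nat) :
  `| estimate R s - N%:R | < 1 / 2 -> reads_positive s = (0 < N)%N.
Proof.
have := integer_bits R (s 0%N); have := fractional_bits R (s 1%N).
rewrite /= ltr_norml /reads_positive /estimate.
move: (\sum_(j < _) _) (\sum_(i < _) _) => F I hF hI /andP[lo hi].
case: N lo hi => [|N] lo hi; last have N1 : 1 <= N.+1%:R :> R by rewrite ler1n.
  move: lo hi hF hI; case: (nilp _); case: (has id _); case: (head false _) => //=;
  rewrite ?expr0 ?expr1; lra.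
move: lo hi hF hI; case: (nilp _); case: (has id _); case: (head false _) => //=;
  rewrite ?expr0 ?expr1; lra.
Qed.

(** Eventually $k\le n^{1/2-\varepsilon}\le n$. The finitely many other [n] go into the constant,
    because efficiency is demanded at every [n]. *)
Lemma admissible_le_linear (R : realType) (eps : R) (k : nat -> nat) :
  0 < eps < 1 / 2 -> admissible eps k -> exists K0, forall n, (k n <= n + K0)%N.
Proof.
move=> he adm.
have [N _ hN] : \forall n \near \oo, (k n <= n)%N.
  near=> n.
  have n1 : (0 < n)%N by near: n; exact: nbhs_infty_gt.
  have /andP[_ le] : (2 + eps) * (ln n%:R / ln 2) <= (k n)%:R <= n%:R `^ (1 / 2 - eps).
    by near: n.
  rewrite -(ler_nat R) (le_trans le) // -[leRHS]powRr1 // ler_powR ?ler1n //; lra.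
exists (\max_(i < N) k i) => n; case: (leqP N n) => [/hN /= h|nN].
  by rewrite (leq_trans h) ?leq_addr.
have /= le := leq_bigmax (F := fun i : 'I_N => k i) (Ordinal nN).
by rewrite (leq_trans le) ?leq_addl.
Unshelve. all: by end_near. Qed.

Lemma admissible_gt1 (R : realType) (eps : R) (k : nat -> nat) :
  0 < eps -> admissible eps k -> \forall n \near \oo, (1 < k n)%N.
Proof.
move=> e0 adm; near=> n.
have n2 : (1 < n)%N by near: n; exact: nbhs_infty_gt.
have /andP[le _] : (2 + eps) * (ln n%:R / ln 2) <= (k n)%:R <= n%:R `^ (1 / 2 - eps).
  by near: n.
rewrite -(ler_nat R) (le_trans _ le) //.
have l2 : 0 < ln 2 :> R by rewrite ln_gt0 // ltr1n.
have : 1 <= ln n%:R / ln 2 :> R.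
  by rewrite ler_pdivlMr // mul1r ler_ln ?posrE ?ltr0n ?ler_nat // ltnW.
nra.
Unshelve. all: by end_near. Qed.

Lemma near_no_large_clique (R : realType) (eps : R) (k : nat -> nat) (delta : R) :
  0 < eps -> admissible eps k -> 0 < delta ->
  \forall n \near \oo,
    \sum_(G : graph n | [exists s : {set 'I_n}, (#|s| == (k n).-1) && is_clique G s])
      gnp_half R G <= delta.
Proof.
move=> e0 adm d0.
(* The square of the union bound is at most a positive power of $n^2/2^{k-2}$. A base at most $1$
   dominates its powers, and a base at most $\delta^2$ then gives $\delta$ after taking roots. *)
have eta0 : 0 < Num.min 1 (delta ^+ 2) by rewrite lt_min ltr01 exprn_gt0.
near=> n.
have k1 : (1 < k n)%N by near: n; exact: admissible_gt1 e0 adm.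
have : (n ^ 2)%:R / 2 ^+ (k n).-2 <= Num.min 1 (delta ^+ 2).
  by near: n; exact: admissible_cvg e0 adm eta0.
rewrite le_min => /andP[le1 led].
apply: le_trans (gnp_half_has_clique R n (k n).-1) _.
rewrite -(ler_pXn2r (isT : (0 < 2)%N)) ?nnegrE ?(ltW d0) ?divr_ge0 ?exprn_ge0 //.
apply: le_trans (sqr_union_bound R n (k n).-1) (le_trans _ led).
rewrite -[leRHS]expr1; apply: ler_wiXn2l => //; last by lia.
Unshelve. all: by end_near. Qed.

Theorem corollary8 (R : realType) (eps : R) (heps : 0 < eps < 1 / 2)
    (hqPC : qPC eps)
    (k : nat -> nat) (hk : admissible eps k)
    (lam : nat -> R) (hlam : \forall n \near \oo, 0 < lam n < (k n)%:R)
    (nu : seq bool -> R) (w : nat -> seq bool)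
    (hnu : forall n, nu (w n) = lam n) (hw : polytime_string R k w)
    (delta : R) (hdelta : 0 < delta) :
  ~ exists A : qalg, efficient R A k w /\
      \forall n \near \oo, 1 / 2 + delta <= success A k lam w (1 / 2) n.
Proof.
move=> [A [effA sucA]]; have /andP[e0 _] := heps.
have [K0 kK] := admissible_le_linear heps hk.
have [B [effB BA]] := estimator_to_distinguisher kK hw effA.
have bad := near_no_large_clique e0 hk hdelta.
apply: (hqPC k hk delta hdelta); exists B; split=> //; near=> n.
have k1 : (1 < k n)%N by near: n; exact: admissible_gt1 e0 hk.
have /andP[lam0 _] : 0 < lam n < (k n)%:R by near: n.
have bad_n : \sum_(G : graph n |
    [exists s : {set 'I_n}, (#|s| == (k n).-1) && is_clique G s]) gnp_half R G <= delta.
  by near: n.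
have : 1 / 2 + delta <= success A k lam w (1 / 2) n by near: n.
rewrite /success /advantage /expect.
under [X in `|X - _|]eq_bigr do rewrite BA.
under [X in `|_ - X|]eq_bigr do rewrite BA.
set a := fun G : graph n => prob R A n (input n (adj_bits G) (k n) (w n)) reads_positive.
set s := fun G : graph n => prob R A n (input n (adj_bits G) (k n) (w n))
  (fun x => `| estimate R x - (low_count G (k n) (lam n))%:R | < 1 / 2).
have -> : \sum_(G : graph n) mixture R (k n) G * s G =
    1 / 2 * (\sum_G gnp_half R G * s G) + 1 / 2 * (\sum_G gnp_planted R (k n) G * s G).
  rewrite !mulr_sumr -big_split; apply: eq_bigr => G _.
  by rewrite /mixture mulrDl !mulrA.
(* A planted graph has a positive count, so each successful run accepts. *)
have planted_le : \sum_G gnp_planted R (k n) G * s G <= \sum_G gnp_planted R (k n) G * a G.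
  apply: ler_sum => G _.
  have [-> |/gnp_planted_clique[S cS clS]] := eqVneq (gnp_planted R (k n) G) 0.
    by rewrite !mul0r.
  rewrite ler_wpM2l ?gnp_planted_ge0 //; apply: le_prob => x /estimate_reads_positive ->.
  exact: low_count_gt0 cS clS.
(* Without a $(k-1)$-clique the count is $0$, so success and acceptance exclude each other and their
   probabilities add up to at most $1$. The remaining graphs add at most their total mass, which is
   at most $\delta$. *)
have half_le : \sum_G gnp_half R G * s G + \sum_G gnp_half R G * a G <= 1 + delta.
  rewrite -big_split /= -(gnp_half_sum R n); apply: le_trans (lerD (lexx _) bad_n).
  rewrite [X in _ + X]big_mkcond -big_split /=; apply: ler_sum => G _.
  rewrite -mulrDr; case: ifPn => [_|/existsPn nocl].
    rewrite -{2 3}[gnp_half R G]mulr1 -mulrDr ler_wpM2l ?gnp_half_ge0 //.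
    by rewrite lerD ?prob_le1.
  rewrite addr0 ler_piMr ?gnp_half_ge0 // prob_disjoint // => x.
  move=> /estimate_reads_positive ->; rewrite low_count_eq0 // => S cS.
  by have := nocl S; rewrite cS eqxx.
(* Success gives $1+2\delta$ for the sum of the two success probabilities. Replacing them by
   acceptance probabilities costs $1+\delta$ and leaves advantage $\delta$. *)
rewrite distrC => h; apply: le_trans (ler_norm _).
lra.
Unshelve. all: by end_near. Qed.
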